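(* Let $\mathcal V\in\mathbb R^{n\times r\times p}$ satisfy $\mathcal V^\top*\mathcal V=\mathcal I_r$, let $\mathcal F\in\mathbb R^{n\times 1\times p}$, and let $I$ be the random index set returned by T-ARP applied to $\mathcal V$. Assume that the frequency alignment and rank growth assumption (stated in the context) holds for $\mathcal V$ with constants $\eta_1,\dots,\eta_r\ge1$, and set $\Gamma_\eta=\prod_{k=1}^r\left(1+\frac{\eta_k}{r-k+1}\right)$. Then $$\mathbb E\left\|\mathcal F-\mathcal V*(\mathcal E_I^\top*\mathcal V)^{-1}*\mathcal E_I^\top*\mathcal F\right\|_F^2\le\Gamma_\eta\|\mathcal F-\mathcal V*\mathcal V^\top*\mathcal F\|_F^2 .$$ In the perfectly aligned case (perfect alignment at every step, so that $\eta_k=1$ for all $k$), $\Gamma_\eta=r+1$.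
   Context: T-product conventions. For a tensor $\mathcal A$ with $p$ frontal slices $A^{(k)}$, its Fourier slices are $\widehat A^{(\ell)}=\sum_{k=1}^p e^{-2\pi i(\ell-1)(k-1)/p}A^{(k)}$, $\ell=1,\dots,p$. The t-product $\mathcal A*\mathcal B$ is the tensor with Fourier slices $\widehat A^{(\ell)}\widehat B^{(\ell)}$. For real $\mathcal A$, $\mathcal A^\top$ is the real tensor with Fourier slices $(\widehat A^{(\ell)})^H$. The identity tensor $\mathcal I_n$ has first frontal slice $I_n$ and all others zero. Inverses and Moore–Penrose pseudoinverses under the t-product are taken slicewise in the Fourier domain. $\|\cdot\|_F$ is the Frobenius norm. For an index tuple $J=(j_1,\dots,j_k)$, $E_J=[e_{j_1},\dots,e_{j_k}]\in\mathbb R^{n\times k}$ and $\mathcal E_J=\mathcal I_n(:,J,:)$ (all of whose Fourier slices equal $E_J$). T-ARP. Input: $\mathcal V\in\mathbb R^{n\times r\times p}$ with $\mathcal V^\top*\mathcal V=\mathcal I_r$. Set $J_0=()$, $\mathcal W^{(0)}=\mathcal V$. For $k=1,\dots,r$: conditionally on $J_{k-1}$, sample $j_k\in\{1,\dots,n\}$ with probability of $j$ equal to $\|\mathcal W^{(k-1)}(j,:,:)\|_F^2/\|\mathcal W^{(k-1)}\|_F^2$; set $J_k=(J_{k-1},j_k)$, $\mathcal Z_k=\mathcal W^{(k-1)}(j_k,:,:)$ and $\mathcal W^{(k)}=\mathcal W^{(k-1)}*(\mathcal I_r-\mathcal Z_k^\dagger*\mathcal Z_k)$. Output: $J_r$ (denoted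 $I$ in the claim). Write $\widehat W^{(k,\ell)}$ for the $\ell$-th Fourier slice of $\mathcal W^{(k)}$. Sampling quantities. For a history $J_{k-1}$ of positive probability, put $a_{j,k}^{(\ell)}=\|\widehat W^{(k-1,\ell)}(j,:)\|_2^2$, $$q_{j,k}=\frac{\sum_{\nu=1}^p a_{j,k}^{(\nu)}}{\sum_{i=1}^n\sum_{\nu=1}^p a_{i,k}^{(\nu)}},\qquad p_{j,k}^{(\ell)}=\frac{a_{j,k}^{(\ell)}}{\sum_{i=1}^n a_{i,k}^{(\ell)}}.$$ Frequency alignment and rank growth assumption (for $\mathcal V$, with constants $\eta_k\ge1$, $k=1,\dots,r$): (i) for every $k=1,\dots,r$, every history $J_{k-1}$ of positive probability, every frequency $\ell$, and every index $j$ with $a_{j,k}^{(\ell)}>0$, one has $q_{j,k}\le\eta_k p_{j,k}^{(\ell)}$; (ii) for every $k=0,1,\dots,r$, every history $J_k$ of positive probability and every frequency $\ell$, $\operatorname{rank}(E_{J_k}^H\widehat V^{(\ell)})=k$. The distributions are perfectly aligned at step $k$ when $q_{j,k}=p_{j,k}^{(\ell)}$ for all $j,\ell$ (for every history of positive probability); this corresponds to $\eta_k=1$. *)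

(* Defs.v *)
From HB Require Import structures.
From mathcomp Require Import all_boot all_order all_algebra.
From mathcomp Require Import complex.
From mathcomp Require Import all_classical all_reals all_analysis.
From mathcomp Require Import ring lra.

Set Implicit Arguments.
Unset Strict Implicit.
Unset Printing Implicit Defensive.

Import Order.TTheory GRing.Theory Num.Theory.

Local Open Scope ring_scope.
Local Open Scope complex_scope.
Local Open Scope sesquilinear_scope.

(* [A k] is the frontal slice $A^{(k+1)}$: frontal slices, Fourier slices and
   row indices are numbered from 0. *)
Definition tensor (K : Type) (n m p : nat) := {ffun 'I_p -> 'M[K]_(n, m)}.

(* The t-product calculus is developed over R[i]; a real tensor enters it
   through this embedding. *)
Definition tcomplex (R : realType) (n m p : nat) (A : tensor R n m p) :
  tensor R[i] n m p := [ffun k => map_mx (real_complex R) (A k)].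

(* $e^{i\theta}$ *)
Definition cis (R : realType) (theta : R) : R[i] := cos theta +i* sin theta.

Lemma cisD (R : realType) (a b : R) : cis (a + b) = cis a * cis b.
Proof.
apply/eqP; rewrite eq_complex /= cosD sinD eqxx /=.
by rewrite addrC eqxx.
Qed.

Lemma cis0 (R : realType) : cis (0 : R) = 1.
Proof. by rewrite /cis cos0 sin0. Qed.

Lemma cisMn (R : realType) (a : R) (k : nat) : cis (a *+ k) = cis a ^+ k.
Proof. by elim: k => [|k IH]; rewrite ?mulr0n ?cis0// mulrS cisD IH exprS. Qed.

Lemma cis_2piMn (R : realType) (k : nat) : cis (2 * pi * k%:R : R) = 1.
Proof.
rewrite mulr_natr cisMn mulr_natl.
by rewrite /cis cos2pi sin2pi expr1n.
Qed.

Lemma cis_neq1 (R : realType) (x : R) : 0 < `|x| < pi -> cis (x *+ 2) != 1.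
Proof.
move=> hx; apply/negP; rewrite eq_complex /= => /andP[/eqP + _].
rewrite cos_mulr2n cos2sin2 => h.
have s0 : sin x = 0.
  by apply/eqP; rewrite -sqrf_eq0; apply/eqP; lra.
have : sin `|x| = 0 by case: (ger0P x) => _; rewrite ?sinN s0 ?oppr0.
by have := sin_gt0_pi hx => /[swap] ->; rewrite ltxx.
Qed.

Lemma cis_orthogonal (R : realType) (p : nat) (a b : 'I_p) :
  \sum_(l < p) cis (2 * pi * (l * a)%:R / p%:R : R) *
               cis (- (2 * pi * (l * b)%:R / p%:R)) = p%:R * (a == b)%:R.
Proof.
have p0 : p%:R != 0 :> R by rewrite pnatr_eq0; case: p a {b} => [[]|].
pose y : R := pi * (a%:R - b%:R) / p%:R.
have E (l : nat) : cis (2 * pi * (l * a)%:R / p%:R : R) *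
    cis (- (2 * pi * (l * b)%:R / p%:R)) = cis (y *+ 2) ^+ l.
  rewrite -cisD -cisMn !natrM; congr cis.
  by rewrite -(mulr_natr _ l) -(mulr_natr y 2) /y; field.
under eq_bigr do rewrite E.
have [ab|nab] := eqVneq a b.
  rewrite /y ab subrr mulr0 mul0r mul0rn cis0 mulr1.
  under eq_bigr do rewrite expr1n.
  by rewrite sumr_const card_ord.
rewrite mulr0; apply: (mulfI (x := cis (y *+ 2) - 1)).
  rewrite subr_eq0; apply: cis_neq1.
  have ppos : 0 < p%:R :> R by rewrite lt_def p0 ler0n.
  have ltap : a%:R < p%:R :> R by rewrite ltr_nat.
  have ltbp : b%:R < p%:R :> R by rewrite ltr_nat.
  have a0 : 0 <= a%:R :> R by rewrite ler0n.
  have b0 : 0 <= b%:R :> R by rewrite ler0n.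
  have pi0 := pi_gt0 R.
  rewrite /y normrM normfV normrM (gtr0_norm pi0) (gtr0_norm ppos).
  rewrite divr_gt0 ?mulr_gt0 ?normr_gt0 ?subr_eq0 ?eqr_nat//=.
  rewrite ltr_pdivrMr// ltr_pM2l// ltr_norml; apply/andP; split; lra.
rewrite -subrX1 mulr0 -E.
apply/eqP; rewrite subr_eq0; apply/eqP.
have F (c : 'I_p) : 2 * pi * (p * c)%:R / p%:R = 2 * pi * c%:R :> R.
  by rewrite natrM; field.
rewrite !F -(cis_2piMn R 0) mulr0 -(subrr (2 * pi * b%:R)) cisD.
by rewrite !cis_2piMn.
Qed.

Section Fourier.
Variables (R : realType) (n m p : nat).

Definition dft (A : tensor R[i] n m p) : tensor R[i] n m p :=
  [ffun l : 'I_p =>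
    \sum_(k < p) cis (- (2 * pi * (l * k)%:R / p%:R)) *: A k].

(* [idft B] is the unique tensor whose Fourier slices are those listed in [B];
   see [idftK] and [dftK] below. *)
Definition idft (B : tensor R[i] n m p) : tensor R[i] n m p :=
  [ffun k : 'I_p =>
    p%:R^-1 *: \sum_(l < p) cis (2 * pi * (l * k)%:R / p%:R) *: B l].

Lemma dftK : cancel dft idft.
Proof.
move=> A; apply/ffunP => k; rewrite ffunE.
have p0 : p%:R != 0 :> R[i] by rewrite pnatr_eq0; case: p k {A} => [[]|].
under eq_bigr do rewrite ffunE scaler_sumr.
rewrite exchange_big /=.
under eq_bigr => k' _.
  under eq_bigr do rewrite scalerA.
  rewrite -scaler_suml cis_orthogonal.
  over.
rewrite (bigD1 k)//= eqxx mulr1 big1 ?addr0 => [|i /negPf ik].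
  by rewrite scalerA mulVf// scale1r.
by rewrite eq_sym ik mulr0 scale0r.
Qed.

Lemma idftK : cancel idft dft.
Proof.
move=> B; apply/ffunP => l; rewrite ffunE.
have p0 : p%:R != 0 :> R[i] by rewrite pnatr_eq0; case: p l {B} => [[]|].
under eq_bigr do rewrite ffunE scalerA mulrC -scalerA scaler_sumr.
rewrite -scaler_sumr exchange_big /=.
under eq_bigr => l' _.
  under eq_bigr do rewrite scalerA mulrC mulnC (mulnC l).
  rewrite -scaler_suml cis_orthogonal.
  over.
rewrite (bigD1 l)//= eqxx mulr1 big1 ?addr0 => [|i /negPf ik].
  by rewrite scalerA mulVf// scale1r.
by rewrite ik mulr0 scale0r.
Qed.

End Fourier.

(* The Moore-Penrose pseudoinverse of a complex matrix, defined by the four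
   Penrose conditions; [mp_invP] and [is_mp_inv_uniq] give its existence and
   uniqueness. *)
Definition is_mp_inv (R : realType) (n m : nat) (A : 'M[R[i]]_(n, m))
    (X : 'M[R[i]]_(m, n)) : Prop :=
  [/\ A *m X *m A = A, X *m A *m X = X,
      (A *m X)^t* = A *m X & (X *m A)^t* = X *m A].

Definition mp_inv (R : realType) (n m : nat) (A : 'M[R[i]]_(n, m)) :
  'M[R[i]]_(m, n) := xget 0 [set X | is_mp_inv A X].

Section MoorePenrose.
Variable R : realType.

Lemma trmxCM (n m q : nat) (A : 'M[R[i]]_(n, m)) (B : 'M[R[i]]_(m, q)) :
  (A *m B)^t* = B^t* *m A^t*.
Proof. by rewrite trmx_mul map_mxM. Qed.

Lemma trmxCV (n : nat) (A : 'M[R[i]]_n) : (invmx A)^t* = invmx (A^t*).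
Proof. by rewrite trmx_inv map_invmx. Qed.

Lemma gram_unit (n m : nat) (G : 'M[R[i]]_(n, m)) :
  row_free G -> G *m G^t* \in unitmx.
Proof.
move=> Gfree; rewrite -row_free_unit; apply: inj_row_free => v v0.
apply: (row_free_inj Gfree); rewrite mul0mx.
have /matrixP/(_ 0 0) : v *m G *m (v *m G)^t* = 0.
  by rewrite trmxCM mulmxA -(mulmxA v) v0 mul0mx.
set u := v *m G; rewrite [LHS]mxE [RHS]mxE.
under eq_bigr => i _ do rewrite [_^t* _ _]mxE [u^T _ _]mxE -normCK.
move/psumr_eq0P => u0; apply/rowP => j; rewrite [RHS]mxE.
have /eqP := u0 (fun i _ => exprn_ge0 2 (normr_ge0 (u 0 i))) j isT.
by rewrite sqrf_eq0 normr_eq0 => /eqP.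
Qed.

Lemma mp_invP (n m : nat) (A : 'M[R[i]]_(n, m)) : is_mp_inv A (mp_inv A).
Proof.
apply: (@xgetPex _ 0 [set X | is_mp_inv A X]).
have [k [L [G [LG Lfull Gfree]]]] :
    exists (k : nat) (L : 'M[R[i]]_(n, k)) (G : 'M[R[i]]_(k, m)),
    [/\ A = L *m G, row_full L & row_free G].
  exists (\rank A), (col_base A), (row_base A).
  by rewrite mulmx_base col_base_full row_base_free.
have Gu : G *m G^t* \in unitmx by apply: gram_unit.
have Lu : L^t* *m L \in unitmx.
  rewrite -{2}(trmxCK L); apply: gram_unit.
  rewrite -row_leq_rank mxrank_map mxrank_tr.
  by move: Lfull; rewrite /row_full => /eqP ->.
exists (G^t* *m invmx (G *m G^t*) *m (invmx (L^t* *m L) *m L^t*)) => /=.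
set P := invmx _; set Q := invmx _.
have AX : A *m (G^t* *m P *m (Q *m L^t*)) = L *m Q *m L^t*.
  by rewrite LG !mulmxA -(mulmxA L) mulmxK.
have XA : G^t* *m P *m (Q *m L^t*) *m A = G^t* *m P *m G.
  by rewrite LG -!mulmxA (mulmxA (L^t*)) (mulmxA Q) mulVmx// mul1mx.
have hP : P^t* = P by rewrite trmxCV trmxCM trmxCK.
have hQ : Q^t* = Q by rewrite trmxCV trmxCM trmxCK.
split.
- by rewrite AX {1}LG !mulmxA -(mulmxA _ (L^t*) L) mulmxKV// -LG.
- by rewrite XA -!mulmxA (mulmxA G) (mulmxA P) mulVmx// mul1mx.
- by rewrite AX !trmxCM hQ trmxCK mulmxA.
- by rewrite XA !trmxCM hP trmxCK mulmxA.
Qed.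

Lemma is_mp_inv_uniq (n m : nat) (A : 'M[R[i]]_(n, m))
    (X Y : 'M[R[i]]_(m, n)) : is_mp_inv A X -> is_mp_inv A Y -> X = Y.
Proof.
move=> [a1 a2 a3 a4] [b1 b2 b3 b4].
have AXY : A *m X = A *m Y.
  by rewrite -{1}b1 -(mulmxA _ A X) -b3 -[in LHS]a3 -trmxCM mulmxA a1 b3.
have XYA : X *m A = Y *m A.
  have -> : X *m A = X *m A *m (Y *m A) by rewrite -mulmxA (mulmxA A) b1.
  by rewrite -a4 -{1}b4 -trmxCM -mulmxA (mulmxA A) a1 b4.
by rewrite -a2 XYA -mulmxA AXY mulmxA b2.
Qed.

End MoorePenrose.

Section TProduct.
Variable R : realType.

Definition tmul (n m q p : nat) (A : tensor R[i] n m p)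
    (B : tensor R[i] m q p) : tensor R[i] n q p :=
  idft [ffun l => dft A l *m dft B l].

Definition ttr (n m p : nat) (A : tensor R[i] n m p) : tensor R[i] m n p :=
  idft [ffun l => (dft A l)^t*].

Definition tid (n p : nat) : tensor R[i] n n p :=
  [ffun k : 'I_p => if val k == 0%N then 1%:M else 0].

Definition tinv (n p : nat) (A : tensor R[i] n n p) : tensor R[i] n n p :=
  idft [ffun l => invmx (dft A l)].

Definition tpinv (n m p : nat) (A : tensor R[i] n m p) : tensor R[i] m n p :=
  idft [ffun l => mp_inv (dft A l)].

(* $\mathcal A(j,:,:)$ and $\mathcal A(:,J,:)$ *)
Definition trow (n m p : nat) (j : 'I_n) (A : tensor R[i] n m p) :
  tensor R[i] 1 m p := [ffun k => row j (A k)].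

Definition tcolsub (n m p k : nat) (J : k.-tuple 'I_m)
    (A : tensor R[i] n m p) : tensor R[i] n k p :=
  [ffun l => colsub (tnth J) (A l)].

(* $E_J = [e_{j_1},\dots,e_{j_k}]$ and $\mathcal E_J$ *)
Definition selmx (n k : nat) (J : k.-tuple 'I_n) : 'M[R[i]]_(n, k) :=
  colsub (tnth J) 1%:M.

Definition tsel (n p k : nat) (J : k.-tuple 'I_n) : tensor R[i] n k p :=
  tcolsub J (tid n p).

Definition fnorm (n m : nat) (A : 'M[R[i]]_(n, m)) : R :=
  Num.sqrt (\sum_i \sum_j ComplexField.Normc.normc (A i j) ^+ 2).

Definition tnorm (n m p : nat) (A : tensor R[i] n m p) : R :=
  Num.sqrt (\sum_k fnorm (A k) ^+ 2).

End TProduct.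

Notation "A *t B" := (tmul A B) (at level 40, left associativity).

Section TARP.
Variables (R : realType) (n r p : nat).
Implicit Types (V W : tensor R[i] n r p) (J : seq 'I_n) (j : 'I_n).

Definition row_prob W j : R := tnorm (trow j W) ^+ 2 / tnorm W ^+ 2.

Definition deflate W j : tensor R[i] n r p :=
  let Z := trow j W in W *t (tid R r p - tpinv Z *t Z).

(* $\mathcal W^{(k)}$ after the history $J = J_k$ *)
Definition tarpW V J : tensor R[i] n r p := foldl deflate V J.

(* [tarp_prob V J] is the probability that the first [size J] indices drawn by
   T-ARP on input [V] are [J]: the product of the successive conditional
   probabilities. *)
Fixpoint tarp_prob V J : R :=
  if J is j :: J' then row_prob V j * tarp_prob (deflate V j) J' else 1.

(* Expectation of X(I), with I the output of T-ARP on input [V]. *)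
Definition tarp_expectation V (X : r.-tuple 'I_n -> R) : R :=
  \sum_(I : r.-tuple 'I_n) tarp_prob V I * X I.

(* The quantities $a_{j,k}^{(\ell)}$, $q_{j,k}$, $p_{j,k}^{(\ell)}$ for the
   history $J = J_{k-1}$. *)
Definition row_mass V J (l : 'I_p) j : R :=
  fnorm (row j (dft (tarpW V J) l)) ^+ 2.

Definition q_prob V J j : R :=
  (\sum_(nu < p) row_mass V J nu j) /
  (\sum_(i < n) \sum_(nu < p) row_mass V J nu i).

Definition p_prob V J (l : 'I_p) j : R :=
  row_mass V J l j / \sum_(i < n) row_mass V J l i.

Definition frequency_alignment V (eta : nat -> R) : Prop :=
  forall k, (1 <= k <= r)%N ->
  forall J : k.-1.-tuple 'I_n, 0 < tarp_prob V J ->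
  forall (l : 'I_p) (j : 'I_n), 0 < row_mass V J l j ->
    q_prob V J j <= eta k * p_prob V J l j.

Definition rank_growth V : Prop :=
  forall k, (k <= r)%N ->
  forall J : k.-tuple 'I_n, 0 < tarp_prob V J ->
  forall l : 'I_p, \rank ((selmx R J)^t* *m dft V l) = k.

(* Only the values of [eta] at 1, ..., r matter. *)
Definition alignment_and_rank_growth V (eta : nat -> R) : Prop :=
  [/\ forall k, (1 <= k <= r)%N -> 1 <= eta k,
      frequency_alignment V eta & rank_growth V].

Definition perfectly_aligned V (k : nat) : Prop :=
  forall J : k.-1.-tuple 'I_n, 0 < tarp_prob V J ->
  forall (j : 'I_n) (l : 'I_p), q_prob V J j = p_prob V J l j.

End TARP.

Definition Gamma (R : realType) (r : nat) (eta : nat -> R) : R :=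
  \prod_(1 <= k < r.+1) (1 + eta k / (r - k + 1)%:R).

(* Main.v *)
(** In each Fourier slice V (orthonormal columns), T-ARP maintains W = V P, where
    P is the orthogonal projection annihilating the selected rows of V, and the
    interpolation error e of the selected entries of g = (1 - V V^H) f is orthogonal
    to the columns of W. Selecting j, with z = W(j,:), replaces e by e - W z^+ e(j),
    so |e|^2 grows by exactly |e(j)|^2 / |z|^2. Since |W|_F^2 = tr P is at least
    r - k + 1 at step k, the alignment bound
    q_j <= eta_k |z|^2 / |W|_F^2 makes the conditional expectation of |e|^2 grow at
    most by the factor 1 + eta_k / (r - k + 1). Rank growth makes the final e equal
    to the oblique projection error, and Parseval's identity sums over the slices. *)
Require Import Defs.
From mathcomp Require Import all_boot all_order all_algebra.
From mathcomp Require Import complex.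
From mathcomp Require Import all_classical all_reals all_analysis.
From mathcomp Require Import ring lra.

Set Implicit Arguments.
Unset Strict Implicit.
Unset Printing Implicit Defensive.

Import Order.TTheory GRing.Theory Num.Theory.
Local Open Scope ring_scope.
Local Open Scope complex_scope.
Local Open Scope sesquilinear_scope.

Local Notation normc := ComplexField.Normc.normc.

(** * Squared Frobenius norms and Parseval's identity *)

Section FrobeniusNorm.
Variable R : realType.

Lemma fnorm_sqr n m (A : 'M[R[i]]_(n, m)) :
  fnorm A ^+ 2 = \sum_i \sum_j normc (A i j) ^+ 2.
Proof.
rewrite sqr_sqrtr //; apply: sumr_ge0 => i _; apply: sumr_ge0 => j _.
exact: sqr_ge0.
Qed.

Lemma normc_sqrE (x : R[i]) : (normc x ^+ 2)%:C = Num.conj x * x.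
Proof. by rewrite rmorphXn /= mulrC -normCK. Qed.

Lemma fnorm_sqrE n m (A : 'M[R[i]]_(n, m)) :
  (fnorm A ^+ 2)%:C = \tr (A^t* *m A).
Proof.
rewrite fnorm_sqr exchange_big /= raddf_sum; apply: eq_bigr => j _.
rewrite mxE raddf_sum; apply: eq_bigr => i _.
by rewrite [LHS]normc_sqrE !mxE.
Qed.

Lemma sum_fnorm_row n m (A : 'M[R[i]]_(n, m)) :
  \sum_i fnorm (row i A) ^+ 2 = fnorm A ^+ 2.
Proof.
rewrite fnorm_sqr; apply: eq_bigr => i _.
by rewrite fnorm_sqr big_ord1; apply: eq_bigr => j _; rewrite mxE.
Qed.

Lemma tnorm_sqr n m p (A : tensor R[i] n m p) :
  tnorm A ^+ 2 = \sum_k fnorm (A k) ^+ 2.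
Proof. by rewrite sqr_sqrtr // sumr_ge0 // => i _; exact: sqr_ge0. Qed.

Lemma conj_cis (t : R) : Num.conj (cis t) = cis (- t).
Proof. by rewrite /cis /Num.conj /= cosN sinN. Qed.

(** Entry by entry, expanding the square and summing over the frequency first kills the cross terms
    by [cis_orthogonal]. The factor [p] appears because [dft] is unnormalised. *)
Lemma parseval n m p (A : tensor R[i] n m p) :
  \sum_l fnorm (dft A l) ^+ 2 = p%:R * tnorm A ^+ 2.
Proof.
have parseval_seq (a : 'I_p -> R[i]) :
    \sum_(l < p) normc (\sum_(k < p) cis (- (2 * pi * (l * k)%:R / p%:R)) * a k) ^+ 2
    = p%:R * \sum_k normc (a k) ^+ 2.
  apply: complexI; rewrite raddf_sum /=.
  under eq_bigr => l _ do
    rewrite normc_sqrE rmorph_sum /= big_distrlr /=.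
  rewrite exchange_big /= rmorphM rmorph_nat raddf_sum mulr_sumr /=.
  apply: eq_bigr => k _; rewrite exchange_big /= normc_sqrE.
  transitivity (\sum_(k' < p) (p%:R * (k == k')%:R) * (Num.conj (a k) * a k')).
    apply: eq_bigr => k' _; rewrite -cis_orthogonal mulr_suml.
    by apply: eq_bigr => l _; rewrite rmorphM /= conj_cis opprK mulrACA.
  rewrite (bigD1 k) //= eqxx mulr1 big1 ?addr0 // => k' /negPf.
  by rewrite eq_sym => ->; rewrite mulr0 mul0r.
rewrite tnorm_sqr.
under eq_bigr do rewrite fnorm_sqr.
under [in RHS]eq_bigr do rewrite fnorm_sqr.
rewrite exchange_big [in RHS]exchange_big mulr_sumr /=; apply: eq_bigr => i _.
rewrite exchange_big [in RHS]exchange_big mulr_sumr /=; apply: eq_bigr => j _.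
rewrite -parseval_seq; apply: eq_bigr => l _; congr (normc _ ^+ 2).
by rewrite ffunE summxE; apply: eq_bigr => k _; rewrite mxE.
Qed.

End FrobeniusNorm.

(** * Slicewise form of the tensor operations *)

Section FourierSlices.
Variable R : realType.

Lemma dftB n m p (A B : tensor R[i] n m p) l : dft (A - B) l = dft A l - dft B l.
Proof.
rewrite !ffunE -sumrB; apply: eq_bigr => k _.
by rewrite !ffunE scalerBr.
Qed.

Lemma dft_tmul n m q p (A : tensor R[i] n m p) (B : tensor R[i] m q p) l :
  dft (A *t B) l = dft A l *m dft B l.
Proof. by rewrite /tmul idftK ffunE. Qed.

Lemma dft_ttr n m p (A : tensor R[i] n m p) l : dft (ttr A) l = (dft A l)^t*.
Proof. by rewrite /ttr idftK ffunE. Qed.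

Lemma dft_tinv n p (A : tensor R[i] n n p) l : dft (tinv A) l = invmx (dft A l).
Proof. by rewrite /tinv idftK ffunE. Qed.

Lemma dft_tpinv n m p (A : tensor R[i] n m p) l :
  dft (tpinv A) l = mp_inv (dft A l).
Proof. by rewrite /tpinv idftK ffunE. Qed.

Lemma dft_trow n m p (A : tensor R[i] n m p) j l :
  dft (trow j A) l = row j (dft A l).
Proof.
apply/rowP => i; rewrite !ffunE mxE !summxE; apply: eq_bigr => k _.
by rewrite ffunE !mxE.
Qed.

Lemma dft_tid n p l : dft (tid R n p) l = 1%:M.
Proof.
case: p l => [[]//|p] l; rewrite ffunE big_ord_recl big1 => [|k _].
  by rewrite !ffunE muln0 mulr0 mul0r oppr0 cis0 scale1r addr0.
by rewrite !ffunE scaler0.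
Qed.

Lemma dft_tsel n p k (J : k.-tuple 'I_n) l : dft (tsel R p J) l = selmx R J.
Proof.
rewrite /selmx -(dft_tid n l); apply/matrixP => i j.
rewrite !ffunE mxE !summxE; apply: eq_bigr => k' _.
by rewrite ffunE !mxE.
Qed.

End FourierSlices.

(** * Pseudoinverse of a single row *)

Section RowPseudoinverse.
Variables (R : realType) (m : nat).
Implicit Type z : 'rV[R[i]]_m.

(** The product is a scalar $c$, and the first Penrose condition reads $(c-1)z=0$. *)
Lemma row_mulmx_mp_inv z : z != 0 -> z *m mp_inv z = 1%:M.
Proof.
move=> z0; case: (mp_invP z) => + _ _ _.
rewrite [z *m mp_inv z]mx11_scalar; set c := (_ *m _) _ _.
rewrite mul_scalar_mx -{2}[z]scale1r => /eqP.
rewrite -subr_eq0 -scalerBl scaler_eq0 (negPf z0) orbF subr_eq0.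
by move=> /eqP ->.
Qed.

Lemma mp_inv0 n : mp_inv (0 : 'M[R[i]]_(n, m)) = 0.
Proof.
by case: (mp_invP (0 : 'M[R[i]]_(n, m))) => _ <- _ _; rewrite mulmx0 mul0mx.
Qed.

Lemma mxtrace_mp_inv_row_le1 z : \tr (mp_inv z *m z) <= 1.
Proof.
have [->|z0] := eqVneq z 0; first by rewrite mulmx0 mxtrace0 ler01.
by rewrite mxtrace_mulC row_mulmx_mp_inv // mxtrace1.
Qed.

(* At [z = 0] this relies on [0^-1 = 0]; the update of the residual is then
   trivial and no case distinction is needed in [arp_step_fnorm]. *)
Lemma fnorm_mp_inv_row z : fnorm (mp_inv z) ^+ 2 = (fnorm z ^+ 2)^-1.
Proof.
have [->|z0] := eqVneq z 0.
  rewrite mp_inv0 !fnorm_sqr !big1 ?invr0 // => i _; rewrite big1 // => j _;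
  by rewrite mxE /= expr0n /= addr0 sqrtr0 expr0n.
have zx := row_mulmx_mp_inv z0; case: (mp_invP z) => _ xzx _ xzH.
(* Since $z^+z$ is Hermitian, $z^+ = z^H |z^+|^2$; multiplying by $z$ on the left gives $1 =
   |z|^2|z^+|^2$. *)
have xE : mp_inv z = z^t* *m ((mp_inv z)^t* *m mp_inv z).
  by rewrite mulmxA -trmxCM xzH xzx.
have h : fnorm z ^+ 2 * fnorm (mp_inv z) ^+ 2 = 1.
  apply: complexI; rewrite rmorphM rmorph1 /= -[_ * _]/(_%:C * _%:C).
  rewrite !fnorm_sqrE mxtrace_mulC.
  rewrite !trace_mx11.
  have := zx; rewrite {1}xE (mulmxA z) => /matrixP/(_ 0 0).
  by rewrite mxE big_ord1 !mxE eqxx.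
have nz : fnorm z ^+ 2 != 0.
  by apply/eqP => h0; move/eqP: h; rewrite h0 mul0r eq_sym oner_eq0.
by apply: (mulfI nz); rewrite h divff.
Qed.

End RowPseudoinverse.

Lemma trmxCB (R : realType) m n (A B : 'M[R[i]]_(m, n)) :
  (A - B)^t* = A^t* - B^t*.
Proof. by rewrite linearB /= raddfB. Qed.

(** * Projection and residual in one Fourier slice *)

Section ARP.
Variables (R : realType) (n r : nat) (V : 'M[R[i]]_(n, r)).
Implicit Types (P : 'M[R[i]]_r) (e g : 'cV[R[i]]_n) (j : 'I_n) (J : seq 'I_n).

(** The deflated slice is stored through the projection $P$, as [V *m P], so that its mass can be
    read off as a trace. *)
Definition arp_step (s : 'M[R[i]]_r * 'cV[R[i]]_n) j :=
  let z := row j (V *m s.1) in let x := mp_inv z in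
  (s.1 *m (1%:M - x *m z), s.2 - V *m s.1 *m (x *m row j s.2)).

Definition arp_state g J := foldl arp_step (1%:M, g) J.

Lemma arp_state_rcons g J j :
  arp_state g (rcons J j) = arp_step (arp_state g J) j.
Proof. by rewrite /arp_state foldl_rcons. Qed.

Definition arp_inv P e := [/\ P^t* = P, P *m P = P & (V *m P)^t* *m e = 0].

Hypothesis V_orth : V^t* *m V = 1%:M.

Lemma trmxC_proj P : P^t* = P -> (V *m P)^t* *m (V *m P) = P *m P.
Proof. by move=> PH; rewrite trmxCM PH mulmxA -(mulmxA P) V_orth mulmx1. Qed.

Section Step.
Variables (P : 'M[R[i]]_r) (e : 'cV[R[i]]_n) (j : 'I_n).
Hypothesis inv : arp_inv P e.
Let z := row j (V *m P).
Let x := mp_inv z.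

Lemma arp_row_proj : z *m P = z.
Proof. by case: inv => _ PP _; rewrite -row_mul -mulmxA PP. Qed.

(** The pseudoinverse $x$ is a multiple of $z^H$, which $P$ fixes because $zP=z$ and $P$ is
    Hermitian. *)
Lemma arp_proj_pinv : P *m x = x.
Proof.
case: inv => PH _ _; case: (mp_invP z) => _ xzx _ xzH.
rewrite -/x in xzx xzH.
have xE : x = z^t* *m (x^t* *m x) by rewrite mulmxA -trmxCM xzH xzx.
have Pz : P *m z^t* = z^t* by rewrite -{1}PH -trmxCM arp_row_proj.
by rewrite xE (mulmxA P) Pz.
Qed.

Lemma arp_step_proj : P *m (1%:M - x *m z) = P - x *m z.
Proof. by rewrite mulmxBr mulmx1 mulmxA arp_proj_pinv. Qed.

(** From $Px=x$ and $zP=z$, the projection $xz$ lies below $P$, so $P-xz$ is again a projection.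
    Orthogonality survives because $W^HWx=Px=x$ and $(1-xz)x=0$. *)
Lemma arp_step_inv : arp_inv (arp_step (P, e) j).1 (arp_step (P, e) j).2.
Proof.
have [PH PP We] := inv; case: (mp_invP z) => _ xzx _ xzH.
rewrite -/x in xzx xzH.
have P'H : (P - x *m z)^t* = P - x *m z.
  by rewrite trmxCB PH xzH.
rewrite /= -/z -/x; split.
- by rewrite arp_step_proj.
- rewrite arp_step_proj mulmxBl !mulmxBr PP (mulmxA P) arp_proj_pinv.
  by rewrite -(mulmxA x) arp_row_proj (mulmxA (x *m z)) xzx subrr subr0.
- have -> : (V *m (P *m (1%:M - x *m z)))^t* =
      (1%:M - x *m z) *m (V *m P)^t*.
    rewrite mulmxA trmxCM; congr (_ *m _).
    by rewrite trmxCB xzH trmx1 map_mx1.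
  rewrite -(mulmxA _ (_^t*)) mulmxBr We sub0r mulmxN.
  rewrite (mulmxA (_^t*)) trmxC_proj // PP (mulmxA P) arp_proj_pinv.
  by rewrite mulmxA mulmxBl mul1mx xzx subrr mul0mx oppr0.
Qed.

Lemma arp_step_trace : \tr (arp_step (P, e) j).1 >= \tr P - 1.
Proof.
rewrite /= -/z -/x arp_step_proj linearB lerD2l lerN2.
exact: mxtrace_mp_inv_row_le1.
Qed.

(** Pythagoras: $e$ is orthogonal to the correction $Wx e(j)$, whose norm is $|x||e(j)|$ since $V$
    is an isometry and $Px=x$. *)
Lemma arp_step_fnorm : fnorm (arp_step (P, e) j).2 ^+ 2 =
  fnorm e ^+ 2 + fnorm (row j e) ^+ 2 / fnorm z ^+ 2.
Proof.
have [PH PP We] := inv.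
rewrite /= -/z -/x -fnorm_mp_inv_row -/x; apply: complexI.
have eW : e^t* *m (V *m P) = 0.
  by rewrite -[LHS]trmxCK trmxCM trmxCK We trmx0 map_mx0.
rewrite [RHS]rmorphD [X in _ = _ + X]rmorphM /= !fnorm_sqrE.
set y := x *m row j e.
have -> : (e - V *m P *m y)^t* *m (e - V *m P *m y) =
    e^t* *m e + y^t* *m y.
  rewrite trmxCB trmxCM mulmxBl !mulmxBr mulmxA eW mul0mx subr0.
  rewrite -(mulmxA (y^t*)) We mulmx0 sub0r opprK; congr (_ + _).
  rewrite mulmxA -(mulmxA _ _ (V *m P)) trmxC_proj // PP -mulmxA.
  by rewrite [P *m y]mulmxA arp_proj_pinv.
rewrite mxtraceD; congr (_ + _).
rewrite /y trmxCM mulmxA -(mulmxA _ (x^t*)) !trace_mx11.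
rewrite -mulmxA [X in X = _]mxE big_ord1 [X in _ * X = _]mxE big_ord1.
by rewrite [in RHS]mxE big_ord1; ring.
Qed.

End Step.

Lemma arp_state_inv g J : V^t* *m g = 0 ->
  arp_inv (arp_state g J).1 (arp_state g J).2.
Proof.
move=> Vg; elim/last_ind: J => [|J j IH].
  by split; rewrite ?trmx1 ?map_mx1 ?mulmx1.
rewrite arp_state_rcons; move: IH; case: (arp_state g J) => P e /= IH.
exact: arp_step_inv.
Qed.

Lemma arp_state_trace g J : V^t* *m g = 0 ->
  r%:R - (size J)%:R <= \tr (arp_state g J).1.
Proof.
move=> Vg; elim/last_ind: J => [|J j IH]; first by rewrite mxtrace1 subr0.
rewrite arp_state_rcons; move: (arp_state_inv J Vg) IH.
case: (arp_state g J) => P e /= Hinv IH.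
apply: le_trans (arp_step_trace j Hinv).
by rewrite size_rcons -[(size J).+1]addn1 natrD opprD addrA lerD2r.
Qed.

(** The squared norm equals the trace of the projection. This bounds the denominator of [p_prob]
    from below. *)
Lemma arp_state_mass g J : V^t* *m g = 0 ->
  r%:R - (size J)%:R <= fnorm (V *m (arp_state g J).1) ^+ 2.
Proof.
move=> Vg; have [PH PP _] := arp_state_inv J Vg.
rewrite -lecR fnorm_sqrE trmxC_proj // PP rmorphB !rmorph_nat.
exact: arp_state_trace.
Qed.

(** * Rank growth and interpolation at the selected rows *)

Definition rowspan J : 'M[R[i]]_r := (\sum_(j <- J) <<row j V>>)%MS.

Lemma rowspan_rcons J j : rowspan (rcons J j) = (rowspan J + <<row j V>>)%MS.
Proof. by rewrite /rowspan -cats1 big_cat big_seq1. Qed.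

Lemma rowspan_rank_rcons J j :
  (\rank (rowspan (rcons J j)) <= (\rank (rowspan J)).+1)%N.
Proof.
rewrite rowspan_rcons (leq_trans (mxrank_adds_leqif _ _)) // -[leqRHS]addn1 leq_add2l.
by rewrite genmxE rank_leq_row.
Qed.

Lemma rowspan_rank J : (\rank (rowspan J) <= size J)%N.
Proof.
elim/last_ind: J => [|J j IH]; first by rewrite /rowspan big_nil mxrank0.
by rewrite size_rcons (leq_trans (rowspan_rank_rcons _ _)) // ltnS.
Qed.

Lemma row_sub_rowspan J j : j \in J -> (row j V <= rowspan J)%MS.
Proof.
elim/last_ind: J => // J i IH; rewrite mem_rcons inE rowspan_rcons.
case/predU1P => [->|/IH {}IH]; last exact: submx_trans (addsmxSl _ _).
by apply: submx_trans (addsmxSr _ _); rewrite genmxE.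
Qed.

Lemma row_selmxM k (J : k.-tuple 'I_n) m (A : 'M[R[i]]_(n, m)) (i : 'I_k) :
  row i ((selmx R J)^t* *m A) = row (tnth J i) A.
Proof.
have -> : (selmx R J)^t* = rowsub (tnth J) 1%:M.
  apply/matrixP => a b; rewrite !mxE eq_sym.
  by case: eqP => _; rewrite ?conjC1 ?conjC0.
by rewrite mul_rowsub_mx mul1mx row_rowsub.
Qed.

(** Carries the rank assumption, phrased with [selmx] and tuples, over to sequences, where histories
    can be extended by induction. *)
Lemma selmx_rank_rowspan k (J : k.-tuple 'I_n) :
  (\rank ((selmx R J)^t* *m V) <= \rank (rowspan J))%N.
Proof.
apply/mxrankS/row_subP => i; rewrite row_selmxM.
exact/row_sub_rowspan/mem_tnth.
Qed.

(** A step adds $xz$ to $1-P$, and $z = v_j - v_j(1-P)$, with $v_j$ the selected row of $V$, lies in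
    the enlarged span. *)
Lemma arp_state_complement g J : V^t* *m g = 0 ->
  (1%:M - (arp_state g J).1 <= rowspan J)%MS.
Proof.
move=> Vg; elim/last_ind: J => [|J j IH]; first by rewrite subrr sub0mx.
rewrite arp_state_rcons rowspan_rcons; move: (arp_state_inv J Vg) IH.
case: (arp_state g J) => P e /= Hinv IH.
rewrite (arp_step_proj j Hinv) opprB addrCA addrC addmx_sub //.
  exact: submx_trans (addsmxSl _ _).
apply: mulmx_sub.
have -> : row j (V *m P) = row j V - row j V *m (1%:M - P).
  by rewrite mulmxBr mulmx1 opprB addrC subrK row_mul.
apply: addmx_sub; first by apply: submx_trans (addsmxSr _ _); rewrite genmxE.
rewrite eqmx_opp; apply/mulmx_sub/(submx_trans IH); exact: addsmxSl.
Qed.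

(** If the deflated row vanished, row [j] of [V] would equal its image under $1-P$, hence lie in the
    previous span, and the rank could not grow. *)
Lemma arp_row_neq0 g J j : V^t* *m g = 0 ->
  \rank (rowspan (rcons J j)) = (size J).+1 ->
  row j (V *m (arp_state g J).1) != 0.
Proof.
move=> Vg rk; apply/eqP => z0; have := rowspan_rank J; apply/negP.
rewrite -ltnNge -rk; apply: mxrankS.
rewrite rowspan_rcons addsmx_sub submx_refl genmxE.
have -> : row j V = row j V *m (1%:M - (arp_state g J).1).
  by rewrite mulmxBr mulmx1 -row_mul z0 subr0.
exact/mulmx_sub/arp_state_complement.
Qed.

(** At the new index both rows cancel because $zz^+=1$. At an old index the updates pass through a
    row of $W$ that is already zero, which is why the two claims are proved together. *)
Lemma arp_state_interpolates g J : V^t* *m g = 0 ->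
  \rank (rowspan J) = size J ->
  forall i, i \in J ->
  row i (V *m (arp_state g J).1) = 0 /\ row i (arp_state g J).2 = 0.
Proof.
move=> Vg; elim/last_ind: J => // J j IH rk i.
rewrite size_rcons in rk.
have rkJ : \rank (rowspan J) = size J.
  apply/eqP; rewrite eqn_leq rowspan_rank /= -ltnS -rk.
  exact: rowspan_rank_rcons.
have zx := row_mulmx_mp_inv (arp_row_neq0 Vg rk).
have {rkJ} IH := IH rkJ.
rewrite arp_state_rcons mem_rcons inE; move: zx IH.
case: (arp_state g J) => P e /= zx IH.
rewrite [V *m (P *m _)]mulmxA; set W := V *m P in zx IH *.
rewrite [row i (e - _)]raddfB /= !(row_mul i W).
case/predU1P => [->|/IH [-> ->]]; last by rewrite !mul0mx subrr.
rewrite mulmxBr mulmx1 !(mulmxA (row j W)) zx !mul1mx.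
by split; rewrite subrr.
Qed.

Lemma arp_state_residual g J : exists y, (arp_state g J).2 = g - V *m y.
Proof.
elim/last_ind: J => [|J j [y IH]]; first by exists 0; rewrite mulmx0 subr0.
rewrite arp_state_rcons /= IH.
by eexists; rewrite -addrA -opprD -mulmxA -mulmxDr.
Qed.

(** The residual differs from [f] by some $Vc$ and vanishes at the selected rows; invertibility of
    [M] then determines $c$. *)
Lemma arp_state_interpolation (f : 'cV[R[i]]_n) (I : r.-tuple 'I_n) :
  \rank ((selmx R I)^t* *m V) = r ->
  f - V *m invmx ((selmx R I)^t* *m V) *m (selmx R I)^t* *m f =
  (arp_state (f - V *m V^t* *m f) I).2.
Proof.
set M := _^t* *m V; set g := f - V *m V^t* *m f => rk.
have Vg : V^t* *m g = 0.  by rewrite mulmxBr !mulmxA V_orth mul1mx subrr.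
have [y ey] := arp_state_residual g I.
have e0 : (selmx R I)^t* *m (arp_state g I).2 = 0.
  apply/row_matrixP => i; rewrite row_selmxM row0.
  have [] // := @arp_state_interpolates g I Vg _ (tnth I i) (mem_tnth _ _).
  apply/eqP; rewrite eqn_leq rowspan_rank size_tuple /= -{1}rk.
  exact: selmx_rank_rowspan.
have Mu : M \in unitmx by rewrite -row_free_unit /row_free rk.
have fE : f = (arp_state g I).2 + V *m (y + V^t* *m f).
  by rewrite ey mulmxDr mulmxA addrA subrK subrK.
rewrite -[in LHS]mulmxA.
have -> : (selmx R I)^t* *m f = M *m (y + V^t* *m f).
  by rewrite {1}fE (mulmxDr ((selmx R I)^t*)) e0 add0r mulmxA.
by rewrite mulmxA mulmxKV // {1}fE addrK.
Qed.

End ARP.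

Lemma sum_tuple_cons (M : nmodType) (T : finType) m (F : seq T -> M) :
  \sum_(I : m.+1.-tuple T) F I = \sum_j \sum_(I : m.-tuple T) F (j :: I).
Proof.
rewrite pair_big /=
  (reindex (fun x : T * m.-tuple T => [tuple of x.1 :: x.2])) //.
exists (fun I : m.+1.-tuple T => (thead I, [tuple of behead I])).
- by move=> [j I] _; congr (_, _); apply: val_inj.
- by move=> I _; rewrite /= -tuple_eta.
Qed.

(** The product telescopes: passing from [r] to [r.+1] puts the factor $(r+2)/(r+1)$ in front and
    shifts the others. *)
Lemma Gamma_const1 (R : realType) r : Gamma r (fun=> 1 : R) = (r + 1)%:R.
Proof.
rewrite /Gamma; elim: r => [|r IH]; first by rewrite big_geq.
rewrite big_ltn // big_add1 /= IH subn1 /= !natrD -[r.+1]addn1 natrD.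
have r0 : (r%:R : R) >= 0 by exact: ler0n.
by field; rewrite gt_eqF //; lra.
Qed.

(** * Sampling probabilities and expected residual energy *)

Section TARPAnalysis.
Variables (R : realType) (n r p : nat).
Hypothesis p_gt0 : (0 < p)%N.
Implicit Types (W : tensor R[i] n r p) (J : seq 'I_n) (j : 'I_n).

Let pR_neq0 : p%:R != 0 :> R. Proof. by rewrite pnatr_eq0 -lt0n. Qed.

Lemma tnorm_dft a b (A : tensor R[i] a b p) :
  tnorm A ^+ 2 = p%:R^-1 * \sum_l fnorm (dft A l) ^+ 2.
Proof. by rewrite parseval mulKf. Qed.

Lemma row_prob_ge0 W j : 0 <= row_prob W j.
Proof. by rewrite divr_ge0 ?sqr_ge0. Qed.

Lemma tarp_prob_ge0 W J : 0 <= tarp_prob W J.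
Proof. by elim: J W => //= j J IH W; rewrite mulr_ge0 ?row_prob_ge0. Qed.

Lemma tarp_prob_rcons W J j :
  tarp_prob W (rcons J j) = tarp_prob W J * row_prob (tarpW W J) j.
Proof.
elim: J W => [|i J IH] W /=; first by rewrite mulrC.
by rewrite IH mulrA.
Qed.

(** Only an inequality, since for $W=0$ all quotients are $0$ by the convention on division. *)
Lemma sum_row_prob_le1 W : \sum_j row_prob W j <= 1.
Proof.
rewrite -mulr_suml.
have -> : \sum_j tnorm (trow j W) ^+ 2 = tnorm W ^+ 2.
  rewrite tnorm_sqr; under eq_bigr do rewrite tnorm_sqr.
  rewrite exchange_big; apply: eq_bigr => k _; rewrite -sum_fnorm_row.
  by apply: eq_bigr => j _; rewrite ffunE.
by have [->|h] := eqVneq (tnorm W ^+ 2) 0; rewrite ?mul0r // divff.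
Qed.

(** The Parseval factors of numerator and denominator cancel. *)
Lemma row_probE W J j : row_prob (tarpW W J) j = q_prob W J j.
Proof.
rewrite /row_prob /q_prob !tnorm_dft exchange_big.
under [in X in _ = _ / X]eq_bigr do rewrite sum_fnorm_row.
rewrite -mulf_div divff ?invr_eq0 // mul1r; congr (_ / _).
by apply: eq_bigr => l _; rewrite dft_trow.
Qed.

(** Here [g] is arbitrary: the projection component of the state never reads the residual. *)
Lemma dft_tarpW W g J l :
  dft (tarpW W J) l = dft W l *m (arp_state (dft W l) g J).1.
Proof.
elim/last_ind: J => [|J j IH]; first by rewrite mulmx1.
rewrite /tarpW foldl_rcons -/(tarpW W J) arp_state_rcons /deflate.
by rewrite dft_tmul dftB dft_tid dft_tmul dft_tpinv dft_trow IH /= mulmxA.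
Qed.

Variables (V : tensor R[i] n r p) (eta : nat -> R) (g : 'I_p -> 'cV[R[i]]_n).
Hypothesis V_orth : forall l, (dft V l)^t* *m dft V l = 1%:M.
Hypothesis V_align : frequency_alignment V eta.
Hypothesis eta_ge1 : forall k, (1 <= k <= r)%N -> 1 <= eta k.
Hypothesis Vg : forall l, (dft V l)^t* *m g l = 0.

Definition residual_energy J : R :=
  \sum_l fnorm (arp_state (dft V l) (g l) J).2 ^+ 2.

Lemma sampling_weight_le J j l : (size J < r)%N -> 0 < tarp_prob V J ->
  q_prob V J j / row_mass V J l j <= eta (size J).+1 / (r - size J)%:R.
Proof.
move=> Jr J0.
have eta0 : 0 <= eta (size J).+1 by apply: le_trans (eta_ge1 _); rewrite ?ler01.
have rJ : 0 < (r - size J)%:R :> R by rewrite ltr0n subn_gt0.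
have a_ge0 : 0 <= row_mass V J l j by exact: sqr_ge0.
(* Alignment says nothing about a vanishing row, but there the quotient is $0$ by convention. *)
have [a0|a0] := eqVneq (row_mass V J l j) 0.
  by rewrite a0 invr0 mulr0 divr_ge0 // ltW.
have a_gt0 : 0 < row_mass V J l j by rewrite lt_def a0.
have S_ge : (r - size J)%:R <= \sum_i row_mass V J l i.
  rewrite sum_fnorm_row (dft_tarpW _ (g l)) natrB ?(ltnW Jr) //.
  exact: arp_state_mass.
rewrite ler_pdivrMr //.
apply: le_trans (V_align (k := (size J).+1) (J := in_tuple J) Jr J0 a_gt0) _.
rewrite -mulrA ler_wpM2l // /p_prob mulrC ler_wpM2r //.
by rewrite lef_pV2 // posrE (lt_le_trans rJ).
Qed.

(** In each slice the old energy is weighted by a total probability of at most $1$, and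
    [sampling_weight_le] bounds the coefficient of each $|e(j)|^2$, which sum to $|e|^2$. *)
Lemma residual_energy_step J : (size J < r)%N -> 0 < tarp_prob V J ->
  \sum_j row_prob (tarpW V J) j * residual_energy (rcons J j)
  <= (1 + eta (size J).+1 / (r - size J)%:R) * residual_energy J.
Proof.
move=> Jr J0; under eq_bigr do rewrite mulr_sumr.
rewrite exchange_big mulr_sumr; apply: ler_sum => l _.
have Hinv := arp_state_inv (V_orth l) J (Vg l).
set e := (arp_state (dft V l) (g l) J).2.
have stepE j : fnorm (arp_state (dft V l) (g l) (rcons J j)).2 ^+ 2 =
    fnorm e ^+ 2 + fnorm (row j e) ^+ 2 / row_mass V J l j.
  rewrite /row_mass (dft_tarpW _ (g l)) arp_state_rcons
    -(arp_step_fnorm (V_orth l) j Hinv).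
  by rewrite -surjective_pairing.
under eq_bigr do rewrite stepE mulrDr.
rewrite big_split mulrDl mul1r /= lerD //.
  by rewrite -mulr_suml ler_piMl ?sqr_ge0 ?sum_row_prob_le1.
rewrite -sum_fnorm_row mulr_sumr; apply: ler_sum => j _.
rewrite mulrCA mulrC ler_wpM2r ?sqr_ge0 // row_probE.
exact: sampling_weight_le.
Qed.

(** Induction on the number of remaining draws, for all histories at once; the first of them is
    split off and the rest is handled from the extended history. *)
Lemma expected_residual_energy m J : (size J + m)%N = r ->
  0 < tarp_prob V J ->
  \sum_(I : m.-tuple 'I_n) tarp_prob (tarpW V J) I * residual_energy (J ++ I)
  <= \prod_((size J).+1 <= k < r.+1) (1 + eta k / (r - k + 1)%:R) *
     residual_energy J.
Proof.
elim: m J => [|m IH] J Jm J0.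
  rewrite big_geq -?Jm ?addn0 // (big_pred1 [tuple]) /= => [|I].
    by rewrite cats0.
  by apply/esym/eqP; exact: tuple0.
rewrite (sum_tuple_cons _ (fun I : seq _ =>
  tarp_prob (tarpW V J) I * residual_energy (J ++ I))).
have Jr : (size J < r)%N by rewrite -Jm addnS ltnS leq_addr.
set c := \prod_((size J).+2 <= k < r.+1) (1 + eta k / (r - k + 1)%:R).
have c_ge0 : 0 <= c.
  rewrite /c big_nat; apply: prodr_ge0 => k /andP[k1 k2].
  rewrite addr_ge0 // divr_ge0 //; apply: le_trans (eta_ge1 _); first by [].
  by rewrite (leq_trans _ k1).
rewrite big_ltn // -/c addn1 subnSK //.
apply: (@le_trans _ _ (c *
    \sum_j row_prob (tarpW V J) j * residual_energy (rcons J j))).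
  rewrite mulr_sumr; apply: ler_sum => j _ /=.
  under eq_bigr do rewrite -mulrA -cat_rcons.
  rewrite -mulr_sumr mulrCA.
  (* The induction hypothesis needs an extended history of positive probability; a null index
     contributes nothing. *)
  have [->|q0] := eqVneq (row_prob (tarpW V J) j) 0; first by rewrite !mul0r.
  rewrite ler_wpM2l ?row_prob_ge0 //.
  have := IH (rcons J j); rewrite size_rcons tarp_prob_rcons /tarpW foldl_rcons.
  by apply; rewrite ?addSnnS // mulr_gt0 // lt_def q0 row_prob_ge0.
rewrite mulrAC [leRHS]mulrC ler_wpM2l //.
exact: residual_energy_step.
Qed.

End TARPAnalysis.

Theorem corollary4p14 (R : realType) (n r p : nat) (p_gt0 : (0 < p)%N)
    (V : tensor R n r p) (F : tensor R n 1 p) (eta : nat -> R)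
    (V_orth : ttr (tcomplex V) *t tcomplex V = tid R r p)
    (V_align : alignment_and_rank_growth (tcomplex V) eta) :
  let Vc := tcomplex V in
  let Fc := tcomplex F in
  tarp_expectation Vc
    (fun I : r.-tuple 'I_n =>
       tnorm (Fc - Vc *t tinv (ttr (tsel R p I) *t Vc)
                      *t ttr (tsel R p I) *t Fc) ^+ 2)
    <= Gamma r eta * tnorm (Fc - Vc *t ttr Vc *t Fc) ^+ 2
  /\ ((forall k, (1 <= k <= r)%N -> perfectly_aligned Vc k) ->
      alignment_and_rank_growth Vc (fun=> 1)
      /\ ((forall k, (1 <= k <= r)%N -> eta k = 1) ->
          Gamma r eta = (r + 1)%:R)).
Proof.
move: V_align => [eta_ge1 V_freq V_rank] Vc Fc; split; last first.
  move=> V_perfect; split=> [|eta1].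
    by split=> // k hk J J0 l j _; rewrite mul1r (V_perfect k hk J J0 j l).
  rewrite -(Gamma_const1 R) /Gamma big_nat [RHS]big_nat.
  by apply: eq_bigr => k hk; rewrite eta1.
have orth l : (dft Vc l)^t* *m dft Vc l = 1%:M.
  by rewrite -dft_ttr -dft_tmul V_orth dft_tid.
pose g l := dft Fc l - dft Vc l *m (dft Vc l)^t* *m dft Fc l.
have Vg l : (dft Vc l)^t* *m g l = 0.
  by rewrite mulmxBr !mulmxA orth mul1mx subrr.
have rhsE : tnorm (Fc - Vc *t ttr Vc *t Fc) ^+ 2 =
    p%:R^-1 * residual_energy Vc g [::].
  rewrite tnorm_dft //; congr (_ * _); apply: eq_bigr => l _.
  by rewrite dftB 2!dft_tmul dft_ttr.
have lhsE : tarp_expectation Vc (fun I : r.-tuple 'I_n =>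
      tnorm (Fc - Vc *t tinv (ttr (tsel R p I) *t Vc)
                     *t ttr (tsel R p I) *t Fc) ^+ 2) =
    p%:R^-1 * \sum_(I : r.-tuple 'I_n) tarp_prob Vc I * residual_energy Vc g I.
  rewrite mulr_sumr; apply: eq_bigr => I _; rewrite [RHS]mulrCA.
  (* Null outcomes drop out before [invmx] is interpreted, as rank growth ensures invertibility only
     at positive probability. *)
  have [->|I0] := eqVneq (tarp_prob Vc I) 0; first by rewrite !mul0r.
  have {}I0 : 0 < tarp_prob Vc I by rewrite lt_def I0 tarp_prob_ge0.
  congr (_ * _); rewrite tnorm_dft //; congr (_ * _); apply: eq_bigr => l _.
  rewrite -arp_state_interpolation //; last exact: V_rank.
  by rewrite dftB 3!dft_tmul dft_tinv dft_tmul dft_ttr dft_tsel.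
(* Both sides carry the Parseval factor $1/p$; what remains is the bound from the empty history. *)
rewrite lhsE rhsE mulrCA ler_wpM2l ?invr_ge0 ?ler0n //.
exact: (expected_residual_energy p_gt0 orth V_freq eta_ge1 Vg
  (J := [::]) (add0n r) ltr01).
Qed.
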